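(* Let $\mathbf{u}=(u_n)$ be an a-sequence. The following are equivalent: (a) the sequence of ratios $(q_n)$ is bounded; (b) $s_\mathbf{u}(\mathbb{T})\le\mathbb{Q}/\mathbb{Z}$; (c) $s_\mathbf{u}(\mathbb{T})$ is countable; (d) $s_\mathbf{u}(\mathbb{T})$ is an $F_\sigma$-subset of $\mathbb{T}$ (with its usual compact topology); (e) $s_\mathbf{u}(\mathbb{T})$ is $\tau^*_\mathbf{u}$-open; (f) $s_\mathbf{u}(\mathbb{T})$ is $\tau_\mathbf{u}$-open.
   Context: An a-sequence is a strictly increasing sequence of integers $\mathbf{u}=(u_n)_{n\in\mathbb{N}}$ with $u_n\mid u_{n+1}$ for all $n$; its ratios are $q_0=u_0$ and $q_n=u_n/u_{n-1}$ for $n>0$. $\mathbb{T}=\mathbb{R}/\mathbb{Z}$, $\|x\|$ is the distance from $x$ to the nearest integer, $d(x,y)=\|x-y\|$. $s_\mathbf{u}(\mathbb{T})=\{x\in\mathbb{T}: u_nx\to0\text{ in }\mathbb{T}\}$. $\varrho_\mathbf{u}(x,y)=\sup_n\max\{d(x,y),d(u_nx,u_ny)\}$ is a metric on $\mathbb{T}$ and $\tau_\mathbf{u}$ is the topology it induces. $\tau^*_\mathbf{u}$ is the group topology on $\mathbb{T}$ whose filter of neighbourhoods of $0$ is generated by the sets $W_n=\overline{\{x:\varrho_\mathbf{u}(x,0)<1/n\}}$, $n\in\mathbb{N}$, where the closure is taken in the usual topology of $\mathbb{T}$. *)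

(* Defs.v *)
(* The circle T = R/Z is modelled on R : realType:
   a subset of T is a Z-periodic subset of R (its preimage under R -> T). *)
From HB Require Import structures.
From mathcomp Require Import all_boot all_order all_algebra.
From mathcomp Require Import all_classical all_reals all_analysis.
Set Implicit Arguments. Unset Strict Implicit. Unset Printing Implicit Defensive.
Import Order.TTheory GRing.Theory Num.Theory.
Import numFieldNormedType.Exports.
Local Open Scope classical_set_scope.
Local Open Scope ring_scope.

Section Defs.
Variable R : realType.

Definition a_seq (u : nat -> int) : Prop :=
  (forall n, u n < u n.+1) /\ (forall n, (u n %| u n.+1)%Z).

Definition aratio (u : nat -> int) (n : nat) : int :=
  if n is m.+1 then (u m.+1 %/ u m)%Z else u 0%N.

Definition tnorm (x : R) : R :=
  Num.min (x - (Num.floor x)%:~R) ((Num.floor x)%:~R + 1 - x).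

Definition tdist (x y : R) : R := tnorm (x - y).

Definition periodic (A : set R) : Prop :=
  forall x (k : int), A x -> A (x + k%:~R).

Definition s_u (u : nat -> int) : set R :=
  [set x | (fun n : nat => tnorm ((u n)%:~R * x)) @ \oo --> 0].

Definition rho_u (u : nat -> int) (x y : R) : R :=
  sup (range (fun n => Num.max (tdist x y) (tdist ((u n)%:~R * x) ((u n)%:~R * y)))).

Definition tau_open (u : nat -> int) (A : set R) : Prop :=
  forall x, A x -> exists2 e : R, 0 < e & forall y, rho_u u x y < e -> A y.

Definition W_u (u : nat -> int) (n : nat) : set R :=
  closure [set x : R | rho_u u x 0 < n.+1%:R^-1].

(* open in tau*_u : the group topology with neighbourhood base (W_n) at 0 *)
Definition taustar_open (u : nat -> int) (A : set R) : Prop :=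
  forall x, A x -> exists n, forall w, W_u u n w -> A (x + w).

Definition F_sigma_T (A : set R) : Prop :=
  exists F : nat -> set R, (forall k, closed (F k) /\ periodic (F k)) /\
    A = \bigcup_k F k.

(* countable subset of T (T identified with the fundamental domain [0,1)) *)
Definition countable_T (A : set R) : Prop := countable (A `&` `[0, 1[).

Definition sub_QZ (A : set R) : Prop :=
  forall x, A x -> exists q : rat, x = ratr q.

End Defs.

(* Main.v *)
(* If the ratios are bounded by M, then ‖u_n x‖ at least doubles with n as long
   as it stays below 1/(2M); so x with u_n x -> 0 is killed by some u_N.  This
   makes s_u rational, and W_n is killed by u_1 for n large.
   If the ratios are unbounded, pick a sparse sequence p_k with ratios
   Q_k = u_(p_k + 1) / u_(p_k) -> oo and put, for a : nat -> nat,
     x_a = sum_k floor(Q_k / (a_k + 4)) / u_(p_k + 1).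
   Roughly, ‖u_(p_k) x_a‖ is of order 1 / a_k: x_a lies
   in s_u when a -> oo, and does not when a is eventually constant.  Large constant sequences give
   rho_u-small points outside s_u, and since a |-> x_a is continuous, a Baire
   diagonalisation over prefixes of a shows that s_u is not F_sigma. *)
Require Import Defs.
From HB Require Import structures.
From mathcomp Require Import all_boot all_order all_algebra.
From mathcomp Require Import all_classical all_reals all_analysis.
From mathcomp Require Import ring lra zify.
Import Order.TTheory GRing.Theory Num.Theory.
Import numFieldNormedType.Exports.
Local Open Scope classical_set_scope.
Local Open Scope ring_scope.

(** * The distance to the nearest integer *)

Section TorusNorm.
Variable R : realType.
Implicit Types (x y : R) (k : int).

(** With [tnorm_le_dist] this makes [tnorm x] a minimum over integers, the form most later arguments
    use. *)
Lemma tnorm_attained x : exists k, tnorm x = `|x - k%:~R|.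
Proof.
have h1 := floor_le x; have h2 := floorD1_gt x.
rewrite intrD in h2.
rewrite /tnorm; case: (leP (x - (Num.floor x)%:~R)
  ((Num.floor x)%:~R + 1 - x)) => h.
  by exists (Num.floor x); rewrite ger0_norm//; lra.
exists (Num.floor x + 1); rewrite intrD ler0_norm; lra.
Qed.

Lemma tnorm_le_dist x k : tnorm x <= `|x - k%:~R|.
Proof.
have h1 := floor_le x; have h2 := floorD1_gt x.
rewrite intrD in h2.
rewrite /tnorm ge_min; apply/orP.
have [hk|hk] := leP k (Num.floor x).
  have : k%:~R <= (Num.floor x)%:~R :> R by rewrite ler_int.
  by left; rewrite ger0_norm; lra.
have : (Num.floor x + 1)%:~R <= k%:~R :> R by rewrite ler_int; lia.
rewrite intrD => ?.
by right; rewrite ler0_norm; lra.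
Qed.

Lemma tnorm_ge0 x : 0 <= tnorm x.
Proof. by have [k ->] := tnorm_attained x. Qed.

Lemma tnorm_le_norm x : tnorm x <= `|x|.
Proof. by have := tnorm_le_dist x 0; rewrite subr0. Qed.

Lemma tnorm_le1 x : tnorm x <= 1.
Proof.
have h1 := floor_le x; have h2 := floorD1_gt x.
rewrite intrD in h2.
by rewrite /tnorm ge_min; apply/orP; left; lra.
Qed.

Lemma tnorm_triangle x y : tnorm (x + y) <= tnorm x + tnorm y.
Proof.
have [k ->] := tnorm_attained x; have [l ->] := tnorm_attained y.
apply: (le_trans (tnorm_le_dist _ (k + l))).
by rewrite intrD opprD addrACA ler_normD.
Qed.

Lemma tnormN x : tnorm (- x) = tnorm x.
Proof.
have le y : tnorm (- y) <= tnorm y.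
  have [k ->] := tnorm_attained y.
  apply: (le_trans (tnorm_le_dist _ (- k))).
  by rewrite mulrNz -opprD normrN.
by apply: le_anti; rewrite le -{1}[x]opprK le.
Qed.

Lemma tnorm_addz x k : tnorm (x + k%:~R) = tnorm x.
Proof.
have le y l : tnorm (y + l%:~R) <= tnorm y.
  have [m ->] := tnorm_attained y.
  apply: (le_trans (tnorm_le_dist _ (m + l))).
  by rewrite intrD opprD addrACA subrr addr0.
apply: le_anti; rewrite le /=.
by have := le (x + k%:~R) (- k); rewrite mulrNz addrK.
Qed.

Lemma tnorm_small x : `|x| <= 2^-1 -> tnorm x = `|x|.
Proof.
move=> hx; apply: le_anti; rewrite tnorm_le_norm /=.
have [k ->] := tnorm_attained x.
have [->|k0] := eqVneq k 0; first by rewrite subr0.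
have : 1 <= `|k%:~R| :> R by rewrite -intr_norm ler1z; lia.
have := ler_normB x (x - k%:~R).
by rewrite opprB addrC subrK; lra.
Qed.

Lemma tnorm_eq0 x : tnorm x = 0 -> exists k, x = k%:~R.
Proof.
have [k ->] := tnorm_attained x.
by move=> /normr0_eq0/subr0_eq ->; exists k.
Qed.

Lemma tnorm_int k : tnorm (k%:~R : R) = 0.
Proof.
apply: le_anti.
by rewrite tnorm_ge0 (le_trans (tnorm_le_dist _ k))// subrr normr0.
Qed.

(** The map [x |-> tnorm (c * x - y)] is Lipschitz with constant [|c|]. Needed for cosets of the
    integers and for the closure in [W_u]. *)
Lemma closed_tnorm_eq0 (c y : R) : closed [set x | tnorm (c * x - y) = 0].
Proof.
move=> x clx /=; apply/eqP; rewrite eq_le tnorm_ge0 andbT.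
apply/ler_addgt0Pr => e e0; rewrite add0r.
have d0 : 0 < e / (`|c| + 1) by rewrite divr_gt0// ltr_wpDl.
have [z [/= z0 xz]] := clx _ (nbhsx_ballx x _ d0).
have -> : c * x - y = c * (x - z) + (c * z - y) by rewrite mulrBr addrA subrK.
apply: (le_trans (tnorm_triangle _ _)); rewrite z0 addr0.
apply: (le_trans (tnorm_le_norm _)); rewrite normrM.
move: xz; rewrite /ball /= ltr_pdivlMr ?ltr_wpDl// => xz.
apply: (le_trans _ (ltW xz)).
by rewrite mulrC ler_wpM2l// lerDl.
Qed.

(** Shift [x] by an integer to absolute value [tnorm x]; its [m]-fold multiple is still within 1/2
    of 0. *)
Lemma tnorm_muln (m : nat) x :
  m%:R * tnorm x <= 2^-1 -> tnorm (m%:R * x) = m%:R * tnorm x.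
Proof.
have [k ek] := tnorm_attained x => h.
have ex : m%:R * x = m%:R * (x - k%:~R) + (m%:Z * k)%:~R.
  by rewrite intrM -pmulrn -mulrDr subrK.
rewrite ex tnorm_addz tnorm_small; last by rewrite normrM ger0_norm// -ek.
by rewrite normrM ger0_norm// -ek.
Qed.

End TorusNorm.

(** * Signs, divisibility and ratios of an a-sequence *)

Section ASequence.
Variables (u : nat -> int) (hu : a_seq u).

Lemma a_seq_neq0 n : u n != 0.
Proof.
apply/negP => /eqP un0; have [lt dv] := hu.
have := dv n; rewrite un0 dvd0z => /eqP un1.
by have := lt n; rewrite un0 un1.
Qed.

Lemma a_seq_dvd m n : (m <= n)%N -> (u m %| u n)%Z.
Proof.
move=> /subnK <-; elim: (n - m)%N => [|k IH]; first exact: dvdzz.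
by apply: (dvdz_trans IH); have [_ dv] := hu; exact: dv.
Qed.

Lemma a_seq_leq_abs m n : (m <= n)%N -> `|u m| <= `|u n|.
Proof.
move=> /a_seq_dvd; rewrite dvdzE => /dvdn_leq.
by rewrite absz_gt0 a_seq_neq0 => /(_ isT); lia.
Qed.

(** From [u n < u n.+1 <= 0] the absolute value would drop, against divisibility. Only [u 0] can be
    negative, hence the positive indices below. *)
Lemma a_seq_gt0 n : (0 < n)%N -> 0 < u n.
Proof.
case: n => // n _; rewrite ltNge; apply/negP => un.
have [lt _] := hu.
by have := lt n; have := @a_seq_leq_abs n n.+1 (leqnSn n); lia.
Qed.

Lemma a_seq_leq m n : (m <= n)%N -> (0 < n)%N -> `|u m| <= u n.
Proof. by move=> mn n0; rewrite -(gtr0_norm (a_seq_gt0 _ n0)) a_seq_leq_abs. Qed.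

Lemma a_seq_ratio n : (0 < n)%N ->
  exists q : nat, [/\ u n.+1 = u n * q%:Z, aratio u n.+1 = q%:Z & (1 < q)%N].
Proof.
move=> n0; have [lt dv] := hu.
have un := a_seq_gt0 _ n0; have h := lt n.
have e : aratio u n.+1 * u n = u n.+1 by rewrite /aratio divzK.
have r1 : 1 < aratio u n.+1 by rewrite -(ltr_pM2r un) mul1r e.
exists `|aratio u n.+1|%N; rewrite gtz0_abs ?(lt_trans _ r1)//.
by split=> //; [rewrite mulrC e | lia].
Qed.

(** Absolute values, because a negative [u 0] makes the first two ratios negative. *)
Definition ratios_bounded := exists M : int, forall n, `|aratio u n| <= M.

Lemma unbounded_ratio_exists : ~ ratios_bounded ->
  forall n M : nat, exists m q : nat,
    [/\ (n < m)%N, (M <= q)%N & u m.+1 = u m * q%:Z].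
Proof.
move=> nb n M; apply: contrapT => H; apply: nb.
have bnd m : (n < m)%N -> `|aratio u m.+1| <= M%:Z.
  move=> nm; have [|q [e1 e2 q1]] := a_seq_ratio m; first by lia.
  rewrite e2; have [|?] := leqP M q; last lia.
  by move=> Mq; case: H; exists m, q.
(* The sum absorbs the first [n.+2] ratios; [M] bounds all later ones. *)
exists (M%:Z + \sum_(i < n.+2) `|aratio u i|) => m.
have [mn|nm] := ltnP m n.+2.
  rewrite (bigD1 (Ordinal mn))//= addrCA lerDl addr_ge0//.
  by apply: sumr_ge0.
case: m nm => // m nm; rewrite (le_trans (bnd _ _))// lerDl.
by apply: sumr_ge0.
Qed.

(** * The group [s_u], the metric [rho_u], and the consequences of bounded ratios *)

Section Real.
Variable R : realType.
Implicit Types x y : R.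
Let U n : R := (u n)%:~R.

Lemma s_uP x : s_u u x <-> forall e : R, 0 < e ->
  exists N, forall n, (N <= n)%N -> tnorm (U n * x) <= e.
Proof.
split.
  move=> /cvgrPdist_le h e /h [N _ hN]; exists N => n /hN /=.
  by rewrite sub0r normrN ger0_norm ?tnorm_ge0.
move=> h; apply/cvgrPdist_le => e /h [N hN]; exists N => // n /= /hN.
by rewrite sub0r normrN ger0_norm ?tnorm_ge0.
Qed.

Lemma s_uD x y : s_u u x -> s_u u y -> s_u u (x + y).
Proof.
move=> /s_uP hx /s_uP hy; apply/s_uP => e e0.
have e2 : 0 < e / 2 by lra.
have [N hN] := hx _ e2; have [M hM] := hy _ e2.
exists (maxn N M) => n; rewrite geq_max => /andP[nN nM].
have := tnorm_triangle _ (U n * x) (U n * y).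
by rewrite -mulrDr; have := hN _ nN; have := hM _ nM; lra.
Qed.

Lemma s_u_tnorm0 N x : tnorm (U N * x) = 0 -> s_u u x.
Proof.
move=> /tnorm_eq0[k ek]; apply/s_uP => e e0; exists N => n Nn.
have /dvdzP[q eq] := a_seq_dvd _ _ Nn.
rewrite /U eq intrM -mulrA ek -intrM tnorm_int; exact: ltW.
Qed.

(** By [tnorm_muln], each step from [N] on multiplies the norm exactly by a ratio [q >= 2], so a
    nonzero norm would outgrow 1. *)
Lemma tnorm_eq0_ratios_bounded (M : int) N x : (0 < N)%N ->
  (forall n, `|aratio u n| <= M) ->
  (forall n, (N <= n)%N -> 2 * M%:~R * tnorm (U n * x) <= 1) ->
  tnorm (U N * x) = 0.
Proof.
move=> N0 bM small.
have grow k : 2 ^+ k * tnorm (U N * x) <= tnorm (U (k + N)%N * x).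
  elim: k => [|k IH]; first by rewrite mul1r.
  have [|q [e1 e2 q1]] := a_seq_ratio (k + N); first by rewrite addn_gt0 N0 orbT.
  have qM : q%:R <= M%:~R :> R.
    by rewrite pmulrn ler_int -e2 (le_trans (ler_norm _)).
  have sm := small _ (leq_addl k N).
  have t0 := tnorm_ge0 _ (U (k + N)%N * x).
  have q2 : 2 <= q%:R :> R by rewrite ler_nat.
  rewrite addSn /U e1 intrM -pmulrn [_ * q%:R]mulrC -mulrA tnorm_muln.
    rewrite exprS -mulrA (le_trans (ler_wpM2l _ IH))//.
    by rewrite ler_wpM2r.
  have := ler_wpM2r t0 qM; rewrite /U in sm *; lra.
(* This [k] satisfies [t^-1 < 2 ^+ k]. *)
apply/eqP; rewrite eq_le tnorm_ge0 andbT leNgt; apply/negP => t0.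
set t := tnorm _ in t0 grow; pose k := Num.Def.archi_bound t^-1.
have := upper_nthrootP (leqnn k); rewrite -(ltr_pM2r t0) mulVf ?gt_eqF//.
by rewrite ltNge (le_trans (grow k)) ?tnorm_le1.
Qed.

Lemma tdist_le_rho n x y : tdist (U n * x) (U n * y) <= rho_u u x y.
Proof.
apply: (@le_trans _ _ (Num.max (tdist x y) (tdist (U n * x) (U n * y)))).
  by rewrite le_max lexx orbT.
apply: ub_le_sup; last by exists n.
by exists 1 => _ [m _ <-]; rewrite ge_max !tnorm_le1.
Qed.

Lemma rho_le (e : R) x y : tnorm (x - y) <= e ->
  (forall n, tnorm (U n * (x - y)) <= e) -> rho_u u x y <= e.
Proof.
move=> h0 h; apply: ge_sup.
  by exists (Num.max (tdist x y) (tdist (U 0 * x) (U 0 * y))); exists 0%N.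
by move=> _ [m _ <-]; rewrite ge_max /tdist h0 -mulrBr h.
Qed.

Lemma rhoBr x y : rho_u u x y = rho_u u (y - x) 0.
Proof.
congr (sup _); apply: eq_imagel => n _.
by rewrite /tdist !subr0 !mulr0 !subr0 -mulrBr -[x - y]opprB mulrN !tnormN.
Qed.

Lemma ratios_bounded_gt0 (M : int) : (forall n, `|aratio u n| <= M) -> 0 < M.
Proof.
by move=> /(_ 2); have [//|q [_ -> q1]] := a_seq_ratio 1; lia.
Qed.

Lemma s_u_ratios_bounded x : ratios_bounded -> s_u u x ->
  exists2 N, (0 < N)%N & tnorm (U N * x) = 0.
Proof.
move=> [M hM] /s_uP h; have M0 := ratios_bounded_gt0 _ hM.
have M0R : 0 < M%:~R :> R by rewrite ltr0z.
have e0 : 0 < (2 * M%:~R)^-1 :> R by rewrite invr_gt0 mulr_gt0.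
have [N hN] := h _ e0; exists N.+1 => //.
apply: (@tnorm_eq0_ratios_bounded M) => // n /ltnW /hN.
by rewrite -[_^-1]mul1r ler_pdivlMr ?mulr_gt0// [_ * (_ * _)]mulrC.
Qed.

Lemma ratios_bounded_sub_QZ : ratios_bounded -> sub_QZ (@s_u R u).
Proof.
move=> hb x /(s_u_ratios_bounded _ hb)[N N0 /tnorm_eq0[k ek]].
exists (k%:~R / (u N)%:~R); rewrite fmorph_div !rmorph_int -ek /U.
by rewrite mulrAC divff ?mul1r// intr_eq0 a_seq_neq0.
Qed.

(** A small [rho_u]-ball at 0 is killed by [u 1]. Being killed is a closed condition, so it passes
    to [W_u], and [s_u] is stable under sums. *)
Lemma ratios_bounded_taustar : ratios_bounded -> taustar_open u (@s_u R u).
Proof.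
move=> [M hM] x Sx; have M0 := ratios_bounded_gt0 _ hM.
(* The radius becomes [1 / (2M + 1)], below the doubling threshold [1 / (2M)]. *)
exists (2 * `|M|)%N => w Ww; apply: s_uD => //; apply: (@s_u_tnorm0 1).
suff : [set y | tnorm (U 1 * y - 0) = 0] w by rewrite /= subr0.
apply: closed_tnorm_eq0; apply: (closure_subset _ Ww) => y /= hy.
rewrite subr0; apply: (@tnorm_eq0_ratios_bounded M) => // n _.
have := ltW (le_lt_trans (tdist_le_rho n _ _) hy).
have -> : (2 * `|M|).+1%:R = 2 * M%:~R + 1 :> R.
  by rewrite -natr1 natrM -[in RHS](gez0_abs (ltW M0)) -pmulrn.
have M0R : 0 < M%:~R :> R by rewrite ltr0z.
rewrite /tdist mulr0 subr0 -[_^-1]mul1r ler_pdivlMr; last by lra.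
have := tnorm_ge0 _ (U n * y); nra.
Qed.

Lemma taustar_open_tau (A : set R) : taustar_open u A -> tau_open u A.
Proof.
move=> h x /h[n hn]; exists n.+1%:R^-1; first by rewrite invr_gt0 ltr0n.
move=> y hy; rewrite -[y](subrKC x); apply: hn.
by apply: subset_closure; rewrite /= -rhoBr.
Qed.

Lemma sub_QZ_countable (A : set R) : sub_QZ A -> countable_T A.
Proof.
move=> h; apply: (@sub_countable _ _ _ [set: rat]) => //.
apply: (@card_le_trans _ _ _ (range (@ratr R))); last exact: card_image_le.
by apply: subset_card_le => x [/h[q ->] _]; exists q.
Qed.

Lemma s_u_periodic : Defs.periodic (@s_u R u).
Proof.
move=> x k Sx; apply: s_uD => //; apply: (@s_u_tnorm0 0).
by rewrite /U -intrM tnorm_int.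
Qed.

(** [F k] is the coset of the integers through the representative numbered [k], or empty if there is
    none; either way it is closed. *)
Lemma countable_T_F_sigma (A : set R) :
  Defs.periodic A -> countable_T A -> F_sigma_T A.
Proof.
move=> pA /countable_injP[f finj].
pose F k := [set x | exists y, [/\ A y, y \in `[0, 1[%classic, f y = k
  & tnorm (1 * x - y) = 0]].
have AF k x : F k x -> A x.
  move=> [y [Ay _ _ /tnorm_eq0[m]]]; rewrite mul1r => /eqP.
  by rewrite subr_eq addrC => /eqP ->; exact: pA.
exists F; split; last first.
  apply/seteqP; split => [x Ax|x [k _]]; last exact: AF.
  have e : x = x - (Num.floor x)%:~R + (Num.floor x)%:~R by rewrite subrK.
  exists (f (x - (Num.floor x)%:~R)) => //; exists (x - (Num.floor x)%:~R).
  split=> //.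
  - by rewrite -mulrNz; exact: pA.
  - rewrite inE /= in_itv /= subr_ge0 floor_le /=.
    by have := floorD1_gt x; rewrite intrD; lra.
  - by rewrite mul1r {1}e addrC addKr tnorm_int.
move=> k; split; last first.
  move=> x m [y [Ay y1 fy xy]]; exists y; split=> //.
  by rewrite !mul1r in xy *; rewrite addrAC tnorm_addz.
have [[y [Ay y1 fy]]|no] :=
    pselect (exists y, [/\ A y, y \in `[0, 1[%classic & f y = k]).
  suff -> : F k = [set x | tnorm (1 * x - y) = 0] by exact: closed_tnorm_eq0.
  apply/seteqP; split=> [x [z [Az z1 fz e]]|x e]; last by exists y.
  suff -> : y = z by [].
  by apply: finj; rewrite ?fy ?fz// inE; split=> //; rewrite -inE.
suff -> : F k = set0 by exact: closed0.
by apply/seteqP; split=> // x [y [Ay y1 fy _]]; apply: no; exists y.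
Qed.

(** * Unbounded ratios: points built from digits along a sparse subsequence *)

Section Unbounded.
Variables (p Q : nat -> nat).
Hypotheses (p_gt0 : forall k, (0 < p k)%N) (p_lt : forall k, (p k < p k.+1)%N).
Hypotheses (Q_ge : forall k, (k.+2 <= Q k)%N).
Hypothesis uQ : forall k, u (p k).+1 = u (p k) * (Q k)%:Z.
Implicit Types a b : nat -> nat.

Let s k : R := U (p k).

(** The denominator is [u (p k).+1]. The shift by 4 keeps the tails, scaled by [s k], within 1/2,
    where [tnorm] is the absolute value. *)
Definition digit_term a k : R := (Q k %/ (a k).+4)%:R / (s k * (Q k)%:R).
Definition digit_sum a : R := limn (series (digit_term a)).

Let p_ge k : (k < p k)%N.
Proof. by elim: k => [|k IH]; [exact: p_gt0 | exact: leq_ltn_trans (p_lt k)]. Qed.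

Let p_homo i j : (i < j)%N -> (p i < p j)%N.
Proof. by apply: (@homo_ltn _ _ (fun m n => (m < n)%N)) => //; exact: ltn_trans. Qed.

Let s_gt0 k : 0 < s k.
Proof. by rewrite ltr0z a_seq_gt0. Qed.

Let Q_gt0 k : 0 < (Q k)%:R :> R.
Proof. by rewrite ltr0n (leq_trans _ (Q_ge k)). Qed.

Let s_double k : 2 * s k <= s k.+1.
Proof.
have := a_seq_leq _ _ (p_lt k) (p_gt0 k.+1).
rewrite gtr0_norm ?a_seq_gt0// -(ler_int R) uQ intrM -pmulrn => h.
apply: (le_trans _ h); rewrite mulrC ler_pM2l ?s_gt0//.
by rewrite ler_nat (leq_trans _ (Q_ge k)).
Qed.

Let s_ge k : k.+1%:R <= s k.
Proof.
elim: k => [|k IH]; first by rewrite (ler_int R 1) -gtz0_ge1 a_seq_gt0.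
have := s_double k; rewrite -natr1.
have : 1 <= k.+1%:R :> R by rewrite ler1n.
lra.
Qed.

Lemma digit_term_ge0 a k : 0 <= digit_term a k.
Proof. by rewrite divr_ge0// ltW// mulr_gt0. Qed.

Lemma digit_term_le a k : digit_term a k <= ((a k).+4%:R * s k)^-1.
Proof.
rewrite /digit_term ler_pdivrMr ?mulr_gt0// ler_pdivlMl ?mulr_gt0 ?ltr0n//.
by rewrite [_%:R * s k]mulrC -mulrA ler_pM2l// -natrM ler_nat mulnC leq_divM.
Qed.

(** By [s_double], [1 / s k <= 2 / s k - 2 / s k.+1], so the bounds [1 / (A * s k)] on the terms
    telescope. *)
Lemma digit_series_le a (A m n : nat) : (0 < A)%N -> (m <= n)%N ->
  (forall k, (m <= k)%N -> (A <= (a k).+4)%N) ->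
  series (digit_term a) n <=
    series (digit_term a) m + (2 / s m - 2 / s n) / A%:R.
Proof.
move=> A0 + hA; move=> /subnKC <-; elim: (n - m)%N => [|j IH].
  by rewrite addn0 subrr mul0r addr0.
rewrite addnS seriesSr; set N := (m + j)%N in IH *.
apply: (le_trans (lerD IH (digit_term_le a N))).
rewrite -addrA lerD2l.
have A0R : 0 < A%:R :> R by rewrite ltr0n.
have h : ((a N).+4%:R * s N)^-1 <= (s N)^-1 / A%:R.
  rewrite -invfM lef_pV2 ?posrE ?mulr_gt0 ?ltr0n// mulrC ler_pM2r//.
  by rewrite ler_nat hA ?leq_addr.
have h2 : 2 / s N.+1 <= (s N)^-1.
  by rewrite ler_pdivrMr// -ler_pdivrMl ?invr_gt0// invrK mulrC.
have i0 : 0 <= A%:R^-1 :> R by rewrite invr_ge0 ltW.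
have h3 := ler_wpM2r i0 h2; apply: (le_trans (lerD (lexx _) h)).
have -> : 2 / s N = (s N)^-1 + (s N)^-1 by rewrite mulrDl mul1r.
rewrite !mulrBl -addrA lerD2l mulrDl; lra.
Qed.

Lemma digit_series_nd a : nondecreasing_seq (series (digit_term a)).
Proof. by apply: nondecreasing_series => k _ _; exact: digit_term_ge0. Qed.

Lemma is_cvg_digit_series a : cvgn (series (digit_term a)).
Proof.
apply: nondecreasing_is_cvgn; first exact: digit_series_nd.
exists (series (digit_term a) 0 + 2 / s 0) => _ [n _ <-].
have := @digit_series_le a 1 0 n isT (leq0n n) (fun _ _ => isT).
rewrite divr1 => /le_trans; apply; rewrite lerD2l gerBl.
by rewrite divr_ge0// ltW.
Qed.

Lemma digit_sum_ge a m : series (digit_term a) m <= digit_sum a.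
Proof.
apply: nondecreasing_cvgn_le; first exact: digit_series_nd.
exact: is_cvg_digit_series.
Qed.

Lemma digit_sum_le a (A m : nat) : (0 < A)%N ->
  (forall k, (m <= k)%N -> (A <= (a k).+4)%N) ->
  digit_sum a <= series (digit_term a) m + 2 / s m / A%:R.
Proof.
move=> A0 hA; apply: limr_le; first exact: is_cvg_digit_series.
exists m => // n /= mn; apply: (le_trans (digit_series_le _ _ _ _ A0 mn hA)).
by rewrite lerD2l ler_wpM2r ?invr_ge0// gerBl divr_ge0// ltW.
Qed.

(** For [k < m] the denominator [u (p k).+1] divides [u n]. *)
Lemma digit_series_int a n m : (forall k, (k < m)%N -> (p k < n)%N) ->
  exists z : int, U n * series (digit_term a) m = z%:~R.
Proof.
elim: m => [_|m IH h]; first by exists 0; rewrite seriesEnat /= big_geq// mulr0.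
have [k km|z ez] := IH; first by apply: h; exact: ltnW.
have /dvdzP[q eq] := a_seq_dvd _ _ (h _ (ltnSn m)).
exists (z + q * (Q m %/ (a m).+4)%:Z); rewrite seriesSr mulrDr ez intrD.
congr (_ + _); rewrite /digit_term /U eq uQ !intrM -!pmulrn /s /U.
have := s_gt0 m; have := Q_gt0 m; rewrite /s /U => h1 h2.
by field; rewrite !gt_eqF.
Qed.

(** The first [m] terms become integral and drop out; the tail is at most [2 / s m / A], and
    [|u n| <= s m]. *)
Lemma tnorm_digit_sum_le a (A n m : nat) : (0 < A)%N ->
  (n <= p m)%N -> (forall k, (k < m)%N -> (p k < n)%N) ->
  (forall k, (m <= k)%N -> (A <= (a k).+4)%N) ->
  tnorm (U n * digit_sum a) <= 2 / A%:R.
Proof.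
move=> A0 nm mn hA; have [z ez] := digit_series_int a _ _ mn.
rewrite -[digit_sum a](subrK (series (digit_term a) m)) mulrDr ez tnorm_addz.
apply: (le_trans (tnorm_le_norm _ _)); rewrite normrM.
rewrite [`|digit_sum a - _|]ger0_norm ?subr_ge0 ?digit_sum_ge//.
have h1 : `|U n| <= s m by rewrite -intr_norm ler_int a_seq_leq.
have h2 : digit_sum a - series (digit_term a) m <= 2 / s m / A%:R.
  by rewrite lerBlDl digit_sum_le.
apply: (@le_trans _ _ (s m * (2 / s m / A%:R))).
  by apply: ler_pM => //; rewrite subr_ge0 digit_sum_ge.
by rewrite mulrA [s m * _]mulrC divfK ?gt_eqF.
Qed.

Lemma p_bracket n :
  exists m, (n <= p m)%N /\ forall k, (k < m)%N -> (p k < n)%N.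
Proof.
have ex : exists m, (n <= p m)%N by exists n; exact: ltnW.
exists (ex_minn ex); case: ex_minnP => m nm mmin; split=> // k km.
by rewrite ltnNge; apply/negP => /mmin; rewrite leqNgt km.
Qed.

Lemma digit_sum_s_u a :
  (forall A, exists m, forall k, (m <= k)%N -> (A <= a k)%N) ->
  s_u u (digit_sum a).
Proof.
move=> h; apply/s_uP => e e0.
pose A := Num.Def.archi_bound (2 / e); have [m hm] := h A.
have hA : 2 / e < A%:R by apply: archi_boundP; rewrite divr_ge0// ltW.
have A0 : (0 < A)%N by rewrite -(ltr0n R) (le_lt_trans _ hA)// divr_ge0// ltW.
(* Beyond [p m] the bracketing index [m'] is at least [m], so the tail only involves [k] with
   [A <= a k]. *)
exists (p m).+1 => n pn; have [m' [nm' m'n]] := p_bracket n.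
have mm' : (m <= m')%N.
  rewrite leqNgt; apply/negP => m'm.
  have /ltnW := p_homo _ _ m'm.
  by move/(leq_trans nm')/(leq_trans pn); rewrite ltnn.
apply: (le_trans (@tnorm_digit_sum_le a A n m' A0 nm' m'n _)).
  by move=> k m'k; do 4 apply: leqW; apply: hm; exact: leq_trans m'k.
by rewrite ler_pdivrMr ?ltr0n// mulrC -ler_pdivrMr// ltW.
Qed.

Lemma rho_digit_sum_le a (A : nat) : (0 < A)%N ->
  (forall k, (A <= (a k).+4)%N) -> rho_u u 0 (digit_sum a) <= 2 / A%:R.
Proof.
move=> A0 hA; rewrite rhoBr subr0; apply: rho_le; rewrite subr0.
  apply: (le_trans (tnorm_le_norm _ _)).
  have h0 := digit_sum_ge a 0; have h1 := @digit_sum_le a A 0 A0 (fun k _ => hA k).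
  rewrite seriesEnat /= big_geq// in h0 h1.
  rewrite ger0_norm//; rewrite add0r in h1; apply: (le_trans h1).
  by rewrite ler_wpM2r ?invr_ge0// ler_pdivrMr// ler_peMr// (s_ge 0).
move=> n; have [m [nm mn]] := p_bracket n.
by apply: (@tnorm_digit_sum_le a A n m).
Qed.

(** Modulo 1, [u (p k)] times the sum is [s k] times the tail from [k]. Its first term makes this at
    least [1 / (2A)], and the tail bound keeps it at most [2 / A <= 1/2], so the norm stays away
    from 0. *)
Lemma digit_sum_not_s_u a c m :
  (forall k, (m <= k)%N -> a k = c) -> ~ s_u u (digit_sum a).
Proof.
move=> hc /s_uP h; pose A : R := c.+4%:R.
have A4 : 4 <= A by rewrite ler_nat.
have A0 : 0 < A by lra.
have e0 : 0 < (4 * A)^-1 by rewrite invr_gt0 mulr_gt0.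
have [N hN] := h _ e0.
(* [k >= c.+4] forces [Q k >= c.+4]: the digit is then nonzero, and rounding down loses at most
   half. *)
pose k := maxn N (maxn m c.+4).
have [Nk mk ck] : [/\ (N <= k)%N, (m <= k)%N & (c.+4 <= k)%N].
  by rewrite /k; split; lia.
have [z ez] := digit_series_int a _ _ (fun k' => p_homo k' k).
have := hN _ (leq_trans Nk (ltnW (p_ge k))).
rewrite -[digit_sum a](subrK (series (digit_term a) k)) mulrDr ez tnorm_addz.
set y := digit_sum a - _.
have y1 : digit_term a k <= y.
  by rewrite lerBrDl -seriesSr digit_sum_ge.
have y2 : y <= 2 / s k / A.
  rewrite lerBlDl digit_sum_le// => k' kk'.
  by rewrite hc// (leq_trans mk).
have sk := s_gt0 k; rewrite -/(s k).
have z2 : s k * y <= 2 / A.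
  apply: (le_trans (ler_wpM2l (ltW sk) y2)).
  by rewrite mulrA [s k * _]mulrC divfK ?gt_eqF.
have z1 : (2 * A)^-1 <= s k * y.
  apply: (le_trans _ (ler_wpM2l (ltW sk) y1)).
  rewrite /digit_term hc//.
  have Q0 := Q_gt0 k.
  have -> : s k * ((Q k %/ c.+4)%:R / (s k * (Q k)%:R)) =
     (Q k %/ c.+4)%:R / (Q k)%:R by field; rewrite !gt_eqF.
  rewrite ler_pdivlMr// ler_pdivrMl ?mulr_gt0//.
  rewrite -!natrM ler_nat.
  have Qc : (c.+4 <= Q k)%N.
    by rewrite (leq_trans ck)// (leq_trans _ (Q_ge k))// ltnW.
  have := divn_eq (Q k) c.+4; have := ltn_pmod (Q k) (isT : (0 < c.+4)%N).
  have : (0 < Q k %/ c.+4)%N by rewrite divn_gt0.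
  nia.
have A2 : 2 / A <= 2^-1 by rewrite ler_pdivrMr//; lra.
have A1 : 0 < (2 * A)^-1 by rewrite invr_gt0 mulr_gt0.
have ny : `|s k * y| = s k * y by rewrite ger0_norm// (le_trans (ltW A1) z1).
rewrite tnorm_small ny; last exact: le_trans z2 A2.
rewrite leNgt => /negP; apply; apply: (lt_le_trans _ z1).
by rewrite ltf_pV2 ?posrE ?mulr_gt0//; lra.
Qed.

(** Both sums lie between the common partial sum and that sum plus [2 / s m], where
    [s m >= m.+1]. *)
Lemma digit_sum_close a b m : (forall k, (k < m)%N -> a k = b k) ->
  `|digit_sum a - digit_sum b| <= 2 / m.+1%:R.
Proof.
move=> ab.
have e : series (digit_term a) m = series (digit_term b) m.
  rewrite !seriesEnat /=; apply: eq_big_nat => k /andP[_ km].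
  by rewrite /digit_term ab.
have a1 := digit_sum_ge a m; have b1 := digit_sum_ge b m.
have a2 := @digit_sum_le a 1 m isT (fun _ _ => isT).
have b2 := @digit_sum_le b 1 m isT (fun _ _ => isT).
have : 2 / s m <= 2 / m.+1%:R.
  by rewrite ler_wpM2l// lef_pV2 ?posrE ?ltr0n// s_ge.
rewrite !divr1 -e in a2 b2 b1 *.
set B := 2 / m.+1%:R; set C := 2 / s m in a2 b2 * => h.
by rewrite ler_norml; apply/andP; split; lra.
Qed.

Lemma unbounded_not_tau_open : ~ tau_open u (@s_u R u).
Proof.
have S0 : s_u u (0 : R) by apply: (@s_u_tnorm0 0); rewrite mulr0 (tnorm_int _ 0).
move=> /(_ _ S0)[e e0 he].
(* [c > 2 / e] puts the point of the constant sequence [c] within [e] of 0. *)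
pose c := Num.Def.archi_bound (2 / e).
apply: (@digit_sum_not_s_u (fun=> c) c 0) => //; apply: he.
apply: (le_lt_trans (@rho_digit_sum_le (fun=> c) c.+4 isT (fun=> leqnn _))).
rewrite ltr_pdivrMr ?ltr0n// mulrC -ltr_pdivrMr//.
apply: (@lt_le_trans _ _ c%:R); last by rewrite ler_nat; lia.
by apply: archi_boundP; rewrite divr_ge0// ltW.
Qed.

(* Baire-type diagonalisation: continuing a given prefix by the constant [j]
   leaves [s_u], hence leaves [F j], and does so already for all sequences
   sharing a long enough prefix.  Letting [j] grow gives a point of [s_u]
   outside every [F j]. *)
Lemma unbounded_not_F_sigma : ~ F_sigma_T (@s_u R u).
Proof.
move=> [F [cF SF]].
(* The triple is [(j, f, m)]: the set [F j] to avoid, with [j] also the filling constant, and the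
   first [m] values of [f] as prefix. *)
have step (x : nat * (nat -> nat) * nat) : exists m', (x.2 < m')%N /\ forall b,
    (forall k, (k < m')%N -> b k = if (k < x.2)%N then x.1.2 k else x.1.1) ->
    ~ F x.1.1 (digit_sum b).
  case: x => -[j f] m /=; set g := fun k => if (k < m)%N then f k else j.
  have nFg : (~` F j) (digit_sum g).
    move=> Fg; apply: (@digit_sum_not_s_u g j m); last by rewrite SF; exists j.
    by move=> k mk; rewrite /g ltnNge mk.
  have oF : open (~` F j) by rewrite openC; have [] := cF j.
  have /nbhs_ballP[r /= r0 hr] := open_nbhs_nbhs (conj oF nFg).
  (* Agreement on [(m + M).+1] values leaves a distance of at most [2 / (m + M + 2) < r]. *)
  pose M := Num.Def.archi_bound (2 / r).
  exists (m + M).+1; split; first by rewrite ltnS leq_addr.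
  move=> b bg; apply: hr; rewrite /ball /=.
  apply: (@le_lt_trans _ _ (2 / (m + M).+2%:R)).
    by apply: digit_sum_close => k /bg.
  rewrite ltr_pdivrMr ?ltr0n// mulrC -ltr_pdivrMr//.
  apply: (@lt_le_trans _ _ M%:R); last by rewrite ler_nat; lia.
  by apply: archi_boundP; rewrite divr_ge0// ltW.
have [B hB] := choice step.
(* A state is a sequence with the length of its frozen prefix. Stage [i] fills with [i] beyond the
   prefix, then freezes enough to avoid [F i]. *)
pose fix st j : (nat -> nat) * nat := if j is i.+1 then
  (fun k => if (k < (st i).2)%N then (st i).1 k else i, B (i, (st i).1, (st i).2))
  else (fun=> 0%N, 0%N).
have st2 j : ((st j).2 < (st j.+1).2)%N by have [] := hB (j, (st j).1, (st j).2).
have st2_ge j : (j <= (st j).2)%N by elim: j => // j IH; exact: leq_ltn_trans (st2 j).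
have st2_mono i j : (i <= j)%N -> ((st i).2 <= (st j).2)%N.
  move/subnKC <-; elim: (j - i)%N => [|d IH]; rewrite ?addn0// addnS.
  by apply: (leq_trans IH); exact: ltnW.
have st1 i j k : (i <= j)%N -> (k < (st i).2)%N -> (st j).1 k = (st i).1 k.
  move=> ij ki; rewrite -(subnKC ij).
  elim: (j - i)%N => [|d IH]; first by rewrite addn0.
  by rewrite addnS /= IH (leq_trans ki)// st2_mono// leq_addr.
(* At stage [k.+1] at least [k.+1] values are frozen, so the value at [k] is final. *)
pose b k := (st k.+1).1 k.
have bst j k : (k < (st j).2)%N -> b k = (st j).1 k.
  move=> kj; rewrite /b; have [jk|kj'] := leqP j k.+1; first exact: st1.
  by rewrite (st1 k.+1 j)// ?(ltnW kj')// (leq_trans (st2_ge k.+1)).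
have Sb : s_u u (digit_sum b).
  (* A position outside the prefix frozen at stage [A] is filled at some stage [i >= A], with value
     [i]. *)
  apply: digit_sum_s_u => A; exists (st A).2 => k Ak.
  rewrite /b; have : (A < k.+1)%N by rewrite ltnS (leq_trans (st2_ge A)).
  move: k.+1 => i; elim: i => // i IH; rewrite ltnS => Ai /=.
  case: ifP => // ki; apply: IH.
  rewrite ltn_neqAle Ai andbT; apply/eqP => Ai'.
  by move: ki; rewrite -Ai' ltnNge Ak.
rewrite SF in Sb; case: Sb => j _.
have [_] := hB (j, (st j).1, (st j).2); apply => k /= hk.
exact: (bst j.+1).
Qed.

End Unbounded.

(** * Extraction of the sparse subsequence, and the equivalences *)

Lemma unbounded_subsequence : ~ ratios_bounded ->
  exists p Q : nat -> nat, [/\ forall k, (0 < p k)%N,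
    forall k, (p k < p k.+1)%N, forall k, (k.+2 <= Q k)%N &
    forall k, u (p k).+1 = u (p k) * (Q k)%:Z].
Proof.
move=> /unbounded_ratio_exists h.
have step (x : nat * nat) : exists y : nat * nat,
  [/\ (x.1 < y.1)%N, (x.2 <= y.2)%N & u y.1.+1 = u y.1 * y.2%:Z].
  by have [m [q ?]] := h x.1 x.2; exists (m, q).
have [G hG] := choice step.
(* The second argument of [G] is the lower bound demanded of the next ratio, which yields
   [k.+2 <= Q k]. *)
pose fix y k := if k is i.+1 then G ((y i).1, k.+2) else G (0, 2)%N.
exists (fun k => (y k).1), (fun k => (y k).2); split=> [k|k|k|k].
- by case: k => [|k]; [have [] := hG (0, 2)%N |
    have [] := hG ((y k).1, k.+3) => /= /(leq_trans _) ->].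
- by have [] := hG ((y k).1, k.+3).
- by case: k => [|k]; [have [] := hG (0, 2)%N | have [] := hG ((y k).1, k.+3)].
- by case: k => [|k]; [have [] := hG (0, 2)%N | have [] := hG ((y k).1, k.+3)].
Qed.

End Real.
End ASequence.

Theorem theoremE (R : realType) (u : nat -> int) (hu : a_seq u) :
  let S := @s_u R u in
  let a := exists M : int, forall n, `|aratio u n| <= M in
  [/\ a <-> sub_QZ S, a <-> countable_T S, a <-> F_sigma_T S,
      a <-> taustar_open u S & a <-> tau_open u S].
Proof.
move=> S a.
(* Two cycles through (a): (a), (b), (c), (d) and (a), (e), (f). *)
have ab : a -> sub_QZ S by exact: ratios_bounded_sub_QZ.
have bc : sub_QZ S -> countable_T S by exact: sub_QZ_countable.
have cd : countable_T S -> F_sigma_T S.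
  by apply: countable_T_F_sigma; exact: s_u_periodic.
have da : F_sigma_T S -> a.
  move=> dS; apply: contrapT => /(unbounded_subsequence _ hu)[p [Q [h1 h2 h3 h4]]].
  exact: (@unbounded_not_F_sigma u hu R p Q).
have ae : a -> taustar_open u S by exact: ratios_bounded_taustar.
have ef : taustar_open u S -> tau_open u S by exact: taustar_open_tau.
have fa : tau_open u S -> a.
  move=> fS; apply: contrapT => /(unbounded_subsequence _ hu)[p [Q [h1 h2 h3 h4]]].
  exact: (@unbounded_not_tau_open u hu R p Q).
by split; split; tauto.
Qed.
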